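(* Let $X$ be a real-valued random variable concentrated on an interval $I\subseteq\mathbb{R}$. Suppose that $f$ and $g$ are continuous real-valued functions on $I$, and that $m_f, M_f, m_g, M_g$ are real numbers such that $m_f\leq f(t)\leq M_f$ and $m_g\leq g(t)\leq M_g$ for all $t\in I$. Then \[ \left|\operatorname{Cov}(f(X),g(X))\right| \leq \frac{1}{4}\,(M_f-m_f)(M_g-m_g). \]
   Context: Let $\mu_X$ denote the probability measure induced by $X$ on the Borel sigma-field of $\mathbb{R}$. The random variable $X$ is said to be concentrated on $B\subset\mathbb{R}$ if $\mu_X(B)=1$; in that case, for a measurable function $f$ on $B$, $\mathrm{E}\,f(X)=\int_B f(t)\,d\mu_X(t)$. The covariance of random variables $U$ and $V$ is $\operatorname{Cov}(U,V)=\mathrm{E}\,(U-\mathrm{E}\,U)(V-\mathrm{E}\,V)=\mathrm{E}(UV)-\mathrm{E}\,U\,\mathrm{E}\,V$. The interval $I$ is arbitrary (not necessarily closed or bounded). *)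

(* Defs.v *)
From HB Require Import structures.
From mathcomp Require Import all_boot all_order all_algebra.
From mathcomp Require Import all_classical all_reals all_analysis.

Set Implicit Arguments.
Unset Strict Implicit.
Unset Printing Implicit Defensive.

Import Order.TTheory GRing.Theory Num.Theory numFieldNormedType.Exports.

Local Open Scope classical_set_scope.
Local Open Scope ring_scope.

Definition concentrated_on d (T : measurableType d) (R : realType)
    (P : probability T R) (X : {RV P >-> R}) (B : set R) : Prop :=
  distribution P X B = 1%E.

(* [f(X)] for a function [f] meaningful only on [B], where [X] is concentrated
   on [B]: the values of [f] outside [B] are discarded, and [f(X)] is given the
   value 0 on the null event [X \notin B].  The choice of 0 is immaterial, see
   [expectation_app_on]. *)
Definition app_on d (T : measurableType d) (R : realType)
    (P : probability T R) (B : set R) (f : R -> R) (X : {RV P >-> R}) : T -> R :=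
  (f \_ B) \o X.

Lemma expectation_app_on d (T : measurableType d) (R : realType)
    (P : probability T R) (B : set R) (f : R -> R) (X : {RV P >-> R}) :
  measurable B ->
  (distribution P X).-integrable B (EFin \o f) ->
  ('E_P[app_on B f X] = \int[distribution P X]_(t in B) (f t)%:E)%E.
Proof.
move=> mB fi.
have fi' : (distribution P X).-integrable setT (EFin \o (f \_ B)).
  by rewrite -restrict_EFin; apply/(integrable_mkcond _ mB).
have mfB := measurable_int _ fi'.
rewrite integral_mkcond (restrict_EFin f) unlock integral_distribution//.
apply/integrableP; split.
  exact: (measurable_comp measurableT (@subsetT _ _) mfB (measurable_funPT X)).
case/integrableP: (fi') => _; rewrite ge0_integral_pushforward//.
exact: measurable_int (integrable_abse fi').
Qed.

(* Main.v *)
Require Import Defs.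
From HB Require Import structures.
From mathcomp Require Import all_boot all_order all_algebra.
From mathcomp Require Import all_classical all_reals all_analysis.
From mathcomp Require Import measurable_realfun ess_sup_inf lra ring.

Set Implicit Arguments.
Unset Strict Implicit.
Unset Printing Implicit Defensive.

Import Order.TTheory GRing.Theory Num.Theory numFieldNormedType.Exports.

Local Open Scope classical_set_scope.
Local Open Scope ring_scope.

(** The inequality is Cauchy-Schwarz for the covariance combined with
Popoviciu's bound on the variance. The mean is the constant that minimizes
the mean square distance to U, so Var U is at most the mean of (U - c)^2 for
every constant c; if a <= U <= b almost surely, the midpoint c of [a, b] is
within (b - a)/2 of U, whence Var U <= ((b - a)/2)^2
([variance_le_sqr_half_width]). Cauchy-Schwarz then bounds Cov(U, V) by the
product of the two half-widths ([covariance_le_half_widths]), and replacing U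
by -U, whose range has the same width, bounds the absolute value.

Continuity of f and g on I serves only to make f(X) and g(X) measurable
([measurable_app_on]). Their bounds on I become almost sure bounds because X
lies in I almost surely ([ae_app_on_between]); the value 0 given to f(X) on
the event X \notin I may violate the bounds, which is why all the estimates are
made for almost surely bounded variables. *)

Section bounded_random_variables.
Context (R : realType) (d : measure_display) (T : measurableType d)
  (P : probability T R).
Implicit Types (U V : T -> R) (a b : R).

(** An almost surely bounded variable has a finite essential supremum, and on a
probability space the L^oo functions are L^2. *)
Lemma ae_bounded_Lfun2 U a b : measurable_fun [set: T] U ->
  {ae P, forall w, a <= U w <= b} -> U \in Lfun P 2%:E.
Proof.
move=> mU abU.
apply: (@Lfun_subset _ _ _ P 2%:E +oo%E).
- by rewrite lee1n.
- by rewrite leey.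
- exact: fin_num_measure.
- by rewrite leey.
rewrite inE; apply/andP; split; rewrite inE//=.
rewrite /finite_norm unlock ifT; last first.
  by rewrite [ltRHS](@probability_setT _ _ _ P) lte01.
apply: (@le_lt_trans _ _ (`|a| + `|b|)%:E); last exact: ltry.
apply/ess_supP; apply: filterS abU => w /andP[aU Ub] /=.
rewrite lee_fin.
have /ler_normlP[Na _] := lexx `|a|; have := ler_norm b.
rewrite ler_norml; have := normr_ge0 a; have := normr_ge0 b; lra.
Qed.

(** Popoviciu's inequality: translating by the midpoint c of [a, b] does not
change the variance, which is at most the second moment, and |U - c| is at
most half the width. *)
Lemma variance_le_sqr_half_width U a b : measurable_fun [set: T] U ->
  {ae P, forall w, a <= U w <= b} ->
  ('V_P[U] <= (((b - a) / 2) ^+ 2)%:E)%E.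
Proof.
move=> mU abU.
have U2 := ae_bounded_Lfun2 mU abU.
pose c := (a + b) / 2.
have Uc2 : (U \- cst c)%R \in Lfun P 2%:E
  by rewrite rpredB ?lee1n//= => _; exact: Lfun_cst.
rewrite -(varianceB_cst_r c U2) varianceE//.
apply: (@le_trans _ _ 'E_P[(U \- cst c) ^+ 2])%E.
  rewrite leeBlDr ?leeDl ?sqre_ge0// fin_numX ?expectation_fin_num//.
  exact: Lfun_subset12 (fin_num_measure P _ measurableT) _ Uc2.
rewrite -(expectation_cst P); apply: expectation_le.
- by apply: (@measurable_funX _ _ _ _ (U \- cst c) 2); exact: measurable_funB.
- exact: measurable_cst.
- by move=> x; exact: sqr_ge0.
- by move=> x; exact: sqr_ge0.
apply: filterS abU => w /andP[aU Ub].
have -> : ((U \- cst c) ^+ 2) w = (U w - c) ^+ 2 by [].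
rewrite -[leLHS]real_normK ?num_real// lerXn2r ?nnegrE ?normr_ge0//.
  lra.
rewrite ler_norml /c; lra.
Qed.

(** Cauchy-Schwarz gives the product of the standard deviations, each of which
is at most a half-width. *)
Lemma covariance_le_half_widths U V a b a' b' :
  measurable_fun [set: T] U -> measurable_fun [set: T] V ->
  {ae P, forall w, a <= U w <= b} -> {ae P, forall w, a' <= V w <= b'} ->
  (covariance P U V <= (4^-1 * ((b - a) * (b' - a')))%:E)%E.
Proof.
move=> mU mV abU abV.
(* An event of probability one is not empty, hence a <= b and a' <= b'. *)
have [w [/andP[aU Ub] /andP[aV Vb]]] :
    exists w, a <= U w <= b /\ a' <= V w <= b'.
  have PP : ProperFilter (almost_everywhere P).
    apply: ae_properfilter_algebraOfSetsType.
    by rewrite [ltRHS](@probability_setT _ _ _ P) lte01.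
  exact: (@filter_ex _ _ PP _ (filterI abU abV)).
have U2 := ae_bounded_Lfun2 mU abU; have V2 := ae_bounded_Lfun2 mV abV.
apply: (le_trans (covariance_le U2 V2)).
have -> : 4^-1 * ((b - a) * (b' - a')) = (b - a) / 2 * ((b' - a') / 2) by field.
have a_b : 0 <= (b - a) / 2 by lra.
have a_b' : 0 <= (b' - a') / 2 by lra.
have sd W r : 0 <= r ->
    ('V_P[W] <= (r ^+ 2)%:E)%E -> (sqrte 'V_P[W] <= r%:E)%E.
  move=> r0 VW; rewrite -[leRHS]gee0_abs ?lee_fin// -sqrte_sqr lee_sqrt//.
  by rewrite sqre_ge0.
rewrite EFinM; apply: lee_pmul; rewrite ?sqrte_ge0//.
- by apply: sd => //; exact: variance_le_sqr_half_width.
- by apply: sd => //; exact: variance_le_sqr_half_width.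
Qed.

Lemma abs_covariance_le_half_widths U V a b a' b' :
  measurable_fun [set: T] U -> measurable_fun [set: T] V ->
  {ae P, forall w, a <= U w <= b} -> {ae P, forall w, a' <= V w <= b'} ->
  (`|covariance P U V| <= (4^-1 * ((b - a) * (b' - a')))%:E)%E.
Proof.
move=> mU mV abU abV.
have Pfin : P setT \is a fin_num := fin_num_measure P _ measurableT.
have U2 := ae_bounded_Lfun2 mU abU; have V2 := ae_bounded_Lfun2 mV abV.
have [cov0|cov0] := leP 0%E (covariance P U V).
  by rewrite gee0_abs//; exact: covariance_le_half_widths.
rewrite (lee0_abs (ltW cov0)) -covarianceNl ?Lfun2_mul_Lfun1 ?Lfun_subset12//.
(* -U lies between -b and -a, an interval of the same width. *)
have -> : b - a = - a - - b by ring.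
apply: covariance_le_half_widths => //; first exact: measurableT_comp.
by apply: filterS abU => w /andP[aU Ub]; rewrite !lerN2 Ub.
Qed.

End bounded_random_variables.

Lemma measurable_app_on (R : realType) (d : measure_display) (T : measurableType d)
    (P : probability T R) (X : {RV P >-> R}) (I : set R) (f : R -> R) :
  is_interval I -> {within I, continuous f} ->
  measurable_fun [set: T] (app_on I f X).
Proof.
move=> /is_interval_measurable mI cf.
apply: measurableT_comp; last exact: measurable_funPT.
apply/measurable_restrict => //; rewrite setTI.
exact: subspace_continuous_measurable_fun.
Qed.

Lemma ae_app_on_between (R : realType) (d : measure_display) (T : measurableType d)
    (P : probability T R) (X : {RV P >-> R}) (I : set R) (f : R -> R) (m M : R) :
  measurable I -> concentrated_on X I -> (forall t, I t -> m <= f t <= M) ->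
  {ae P, forall w, m <= app_on I f X w <= M}.
Proof.
move=> mI XI mfM.
have mX A : measurable A -> measurable (X @^-1` A).
  by move=> mA; rewrite -[_ @^-1` _]setTI; exact: (measurable_funPT X).
exists (X @^-1` (~` I)); split; first exact/mX/measurableC.
- have := probability_setC P (mX _ mI).
  by rewrite -preimage_setC => ->; rewrite [P _]XI subee.
move=> w nmM Iw.
by apply: nmM; rewrite /app_on /= patchT ?mem_set//; exact: mfM.
Qed.

Theorem theorem6 (R : realType) (d : measure_display) (T : measurableType d)
    (P : probability T R) (X : {RV P >-> R}) (I : set R) (f g : R -> R)
    (mf Mf mg Mg : R)
    (hI : is_interval I)
    (hX : concentrated_on X I)
    (cf : {within I, continuous f})
    (cg : {within I, continuous g})
    (bf : forall t, I t -> mf <= f t <= Mf)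
    (bg : forall t, I t -> mg <= g t <= Mg) :
  (`|covariance P (app_on I f X) (app_on I g X)|
     <= (4^-1 * ((Mf - mf) * (Mg - mg)))%:E)%E.
Proof.
have mI := is_interval_measurable hI.
apply: abs_covariance_le_half_widths.
- exact: measurable_app_on.
- exact: measurable_app_on.
- exact: ae_app_on_between.
- exact: ae_app_on_between.
Qed.
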